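(* Let $\mathbb{K}$ be $\mathbb{R}$ or $\mathbb{C}$, let $1<p<\infty$, and let $q$ be the conjugate index of $p$, i.e. $\frac1p+\frac1q=1$. Let $(\{f_j\}_{j=1}^n, \{\tau_j\}_{j=1}^n)$ and $(\{g_k\}_{k=1}^n, \{\omega_k\}_{k=1}^n)$ be two p-orthonormal bases for a finite dimensional Banach space $\mathcal{X}$ over $\mathbb{K}$. If $x \in \mathcal{X}\setminus\{0\}$ can be written as $$x=\theta_\tau u=\theta_\omega v \quad \text{for some } u, v \in \mathbb{K}^n,$$ then $$\|u\|_0^{\frac{1}{p}}\,\|v\|_0^{\frac{1}{q}} \geq \frac{1}{\displaystyle\max_{1\leq j, k\leq n}|f_j(\omega_k)|}\quad \text{and} \quad \|v\|_0^{\frac{1}{p}}\,\|u\|_0^{\frac{1}{q}}\geq \frac{1}{\displaystyle\max_{1\leq j, k\leq n}|g_k(\tau_j)|}.$$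
   Context: Let $\{\tau_j\}_{j=1}^n$ be a basis for the finite dimensional Banach space $\mathcal{X}$ over $\mathbb{K}$ and let $\{f_j\}_{j=1}^n$ be the coordinate functionals associated with $\{\tau_j\}_{j=1}^n$. For $1<p<\infty$, the pair $(\{f_j\}_{j=1}^n, \{\tau_j\}_{j=1}^n)$ is called a p-orthonormal basis for $\mathcal{X}$ if the following two conditions hold: (i) $\|f_j\|=\|\tau_j\|=1$ for all $1\leq j\leq n$; (ii) for every $(a_j)_{j=1}^n \in \mathbb{K}^n$, $\left\|\sum_{j=1}^n a_j\tau_j\right\|=\left(\sum_{j=1}^n|a_j|^p\right)^{1/p}$. The maps $\theta_\tau$ and $\theta_\omega$ are the synthesis maps $$\theta_\tau:\mathbb{K}^n\ni (a_j)_{j=1}^n\mapsto \sum_{j=1}^n a_j\tau_j\in\mathcal{X},\qquad \theta_\omega:\mathbb{K}^n\ni (a_k)_{k=1}^n\mapsto \sum_{k=1}^n a_k\omega_k\in\mathcal{X}.$$ For a vector $h\in\mathbb{K}^n$, $\|h\|_0$ denotes the number of nonzero entries of $h$. *)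

(* Defs.v *)
From HB Require Import structures.
From mathcomp Require Import all_boot all_order all_algebra.
From mathcomp Require Import complex.
From mathcomp Require Import boolp classical_sets reals ereal normedtype exp.

Set Implicit Arguments.
Unset Strict Implicit.
Unset Printing Implicit Defensive.

Import Order.TTheory GRing.Theory Num.Theory.
Import numFieldNormedType.Exports.

Local Open Scope classical_set_scope.
Local Open Scope ring_scope.

Variant scalars := RealScalars | ComplexScalars.

Definition scalar_field (R : realType) (k : scalars) : numFieldType :=
  match k with
  | RealScalars => R
  | ComplexScalars => R[i]
  end.

Definition realpart (R : realType) (k : scalars) : scalar_field R k -> R :=
  match k with
  | RealScalars => fun a => a
  | ComplexScalars => fun a => complex.Re a
  end.

(* The norm of a normed space over K takes its values in K (among its
   nonnegative reals); [rnorm] is the same norm, read in R.  It also applies to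
   the scalars themselves, where it is the modulus. *)
Definition rnorm (R : realType) (k : scalars)
    (V : normedZmodType (scalar_field R k)) (x : V) : R :=
  realpart `|x|.

Section Bases.
Context (R : realType) (k : scalars).
Local Notation K := (scalar_field R k).
Context (X : normedModType K) (n : nat).
Implicit Types (tau : 'I_n -> X) (f : 'I_n -> {linear X -> K^o}).

Definition synthesis tau (a : 'rV[K]_n) : X := \sum_j a 0 j *: tau j.

Definition is_basis tau : Prop :=
  (forall a : 'rV[K]_n, synthesis tau a = 0 -> a = 0) /\
  (forall x : X, exists a : 'rV[K]_n, x = synthesis tau a).

Definition coordinate_functionals f tau : Prop :=
  forall (a : 'rV[K]_n) (j : 'I_n), f j (synthesis tau a) = a 0 j.

(* Extended-real valued, so that an unbounded functional has norm +oo. *)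
Definition dual_norm (phi : {linear X -> K^o}) : \bar R :=
  ereal_sup [set (rnorm (phi x : K))%:E | x in [set x : X | rnorm x <= 1]].

Definition p_orthonormal_basis (p : R) f tau : Prop :=
  [/\ is_basis tau,
      coordinate_functionals f tau,
      forall j, dual_norm (f j) = 1%E /\ rnorm (tau j) = 1
    & forall a : 'rV[K]_n,
        rnorm (synthesis tau a) = (\sum_j rnorm (a 0 j) `^ p) `^ p^-1].

Definition norm0 (h : 'rV[K]_n) : nat := #|[pred j | h 0 j != 0]|.

(* The index 0 of the maximum is harmless: the entries are nonnegative. *)
Definition max_coherence f tau : R :=
  \big[Num.max/0]_(j < n) \big[Num.max/0]_(i < n) rnorm (f j (tau i) : K).

End Bases.

(* Main.v *)
Require Import Defs.
From HB Require Import structures.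
From mathcomp Require Import all_boot all_order all_algebra.
From mathcomp Require Import complex.
From mathcomp Require Import boolp classical_sets reals ereal normedtype exp.

Set Implicit Arguments.
Unset Strict Implicit.
Unset Printing Implicit Defensive.

Import Order.TTheory GRing.Theory Num.Theory.
Import numFieldNormedType.Exports.

Local Open Scope ring_scope.

(** Applying f_j to the expansion of x in omega gives
    u_j = sum_k v_k f_j(omega_k), so that |u_j| <= M ||v||_1, where M is the
    coherence. Hence ||u||_p <= ||u||_0^(1/p) M ||v||_1, while Hölder's
    inequality on the support of v gives ||v||_1 <= ||v||_0^(1/q) ||v||_p.
    Both ||u||_p and ||v||_p equal ||x|| > 0, which cancels. *)

Lemma realpartD (R : realType) k (a b : scalar_field R k) :
  realpart (a + b) = realpart a + realpart b.
Proof. by case: k a b => //= -[? ?] [? ?]. Qed.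

Lemma realpart_le (R : realType) k (a b : scalar_field R k) :
  a <= b -> realpart a <= realpart b.
Proof. by case: k a b => //= a b; rewrite lecE => /andP[]. Qed.

(** In the complex case a nonnegative [a] has zero imaginary part, so the cross term in the real
    part of the product vanishes. *)
Lemma realpartM (R : realType) k (a b : scalar_field R k) :
  0 <= a -> realpart (a * b) = realpart a * realpart b.
Proof.
case: k a b => //= -[a a'] [b b'].
by rewrite lecE /= => /andP[/eqP -> _]; rewrite mul0r subr0.
Qed.

Lemma realpart0 (R : realType) k : realpart (0 : scalar_field R k) = 0.
Proof. by case: k. Qed.

Lemma realpart_ge0_eq0 (R : realType) k (a : scalar_field R k) :
  0 <= a -> realpart a = 0 -> a = 0.
Proof.
case: k a => //= -[a a']; rewrite lecE /= => /andP[/eqP -> _] ->.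
by apply/eqP; rewrite eq_complex /= !eqxx.
Qed.

Section Rnorm.
Context (R : realType) (k : scalars).
Local Notation K := (scalar_field R k).

Lemma rnorm_ge0 (V : normedZmodType K) (x : V) : 0 <= rnorm x.
Proof. by rewrite -(realpart0 R k); apply: realpart_le. Qed.

Lemma rnorm_eq0 (V : normedZmodType K) (x : V) : (rnorm x == 0) = (x == 0).
Proof.
apply/eqP/eqP => [/realpart_ge0_eq0 h|->]; last first.
  by rewrite /rnorm normr0 realpart0.
by apply: normr0_eq0; apply: h.
Qed.

Lemma rnormM (a b : K) : rnorm (a * b) = rnorm a * rnorm b.
Proof. by rewrite /rnorm normrM realpartM. Qed.

Lemma ler_rnorm_sum (V : normedZmodType K) (I : finType) (F : I -> V) :
  rnorm (\sum_i F i) <= \sum_i rnorm (F i).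
Proof.
elim/big_ind2: _ => [|x a y b xa yb|//].
  by rewrite /rnorm normr0 realpart0.
by apply: le_trans (lerD xa yb); rewrite /rnorm -realpartD realpart_le ?ler_normD.
Qed.

End Rnorm.

Lemma max_coherence_ge (R : realType) k
    (X : normedModType (scalar_field R k)) n
    (f : 'I_n -> {linear X -> (scalar_field R k)^o}) (tau : 'I_n -> X) i j :
  rnorm (f j (tau i) : scalar_field R k) <= max_coherence f tau.
Proof.
by rewrite /max_coherence; apply: le_trans (le_bigmax _ _ j); apply: le_bigmax.
Qed.

(* Young's inequality, applied to the a i rescaled so that the right-hand side
   becomes the size of the support of a. *)
Lemma sum_le_supp_powR (R : realType) (I : finType) (a : I -> R) (p q : R) :
  0 < p -> 0 < q -> p^-1 + q^-1 = 1 -> (forall i, 0 <= a i) ->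
  \sum_i a i <=
    #|[pred i | a i != 0]|%:R `^ q^-1 * (\sum_i a i `^ p) `^ p^-1.
Proof.
move=> p0 q0 pq a0; set m : R := #|_|%:R; set S := \sum_i a i `^ p.
have p_neq0 := lt0r_neq0 p0.
have S_ge0 : 0 <= S by apply: sumr_ge0 => i _; exact: powR_ge0.
(* The rescaling below divides by S^(1/p), so S = 0, where every [a i] vanishes, is treated
   apart. *)
have [S0|S_neq0] := eqVneq S 0.
  rewrite big1 ?mulr_ge0 ?powR_ge0// => i _; apply/(@powR_eq0_eq0 _ _ p).
  by have/psumr_eq0P := S0; apply=> // j _; exact: powR_ge0.
have S_gt0 : 0 < S by rewrite lt_def S_neq0.
have m_gt0 : 0 < m.
  rewrite ltr0n lt0n; apply: contra_neq S_neq0 => /card0_eq supp0.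
  by apply: big1 => i _; have /negbFE/eqP-> := supp0 i; rewrite powR0.
(* Sums are restricted to the support so that the constant 1/q from Young's inequality is counted m
   times, once per nonzero entry. *)
have suppE (F : I -> R) : (forall i, a i = 0 -> F i = 0) ->
    \sum_i F i = \sum_(i | a i != 0) F i.
  move=> F0; rewrite [RHS]big_mkcond; apply: eq_bigr => i _.
  by case: eqP => //= /F0.
(* This choice makes the p-th powers of the [c * a i] sum to m, so the Young bounds total m/p + m/q
   = m. *)
set c := m `^ p^-1 / S `^ p^-1.
have c_gt0 : 0 < c by rewrite divr_gt0 ?powR_gt0.
have cp : c `^ p = m / S.
  have rootK (y : R) : 0 < y -> (y `^ p^-1) `^ p = y.
    by move=> y_gt0; rewrite -powRrM mulVf// powRr1// ltW.
  rewrite /c powRM ?invr_ge0 ?powR_ge0// -[(S `^ _)^-1]powR_inv1 ?powR_ge0//.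
  by rewrite [_ `^ (-1) `^ _]powRAC !rootK// powR_inv1// ltW.
have : \sum_i c * a i <= m.
  rewrite suppE; last by move=> i ->; rewrite mulr0.
  (* Young's inequality for the product of [c * a i] and 1, with c^p replaced by m/S. *)
  apply: (@le_trans _ _ (\sum_(i | a i != 0) (m / S * a i `^ p / p + q^-1))).
    apply: ler_sum => i _.
    have := @conjugate_powR _ (c * a i) 1 p q.
    rewrite mulr1 powR1 div1r powRM ?(ltW c_gt0)// cp.
    by apply; rewrite // mulr_ge0// ltW.
  rewrite big_split /= -mulr_suml -mulr_sumr -suppE; last first.
    by move=> i ->; rewrite powR0.
  rewrite -/S divfK// sumr_const -[_ *+ _]mulr_natl -/m.
  by rewrite -mulrDr pq mulr1.
(* Dividing by c will leave m / m^(1/p) times S^(1/p), and 1 - 1/p = 1/q. *)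
have -> : m `^ q^-1 = m / m `^ p^-1.
  have -> : q^-1 = 1 - p^-1 by rewrite -pq addrAC subrr add0r.
  by rewrite powRB ?powRr1 ?(ltW m_gt0) ?(lt0r_neq0 m_gt0) ?implybT.
rewrite -mulr_sumr -ler_pdivlMl// => /le_trans; apply.
by rewrite /c invf_div mulrC mulrA mulrAC.
Qed.

Section Uncertainty.
Context (R : realType) (k : scalars).
Local Notation K := (scalar_field R k).
Context (X : normedModType K) (n : nat) (p q : R).

(** One bound suffices for the theorem: the hypotheses are symmetric in the two bases, so exchanging
    [f], [tau], [u] with [g], [omega], [v] gives the other. *)
Lemma norm0_uncertainty (f g : 'I_n -> {linear X -> K^o})
    (tau omega : 'I_n -> X) (x : X) (u v : 'rV[K]_n) :
  1 < p -> p^-1 + q^-1 = 1 ->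
  p_orthonormal_basis p f tau -> p_orthonormal_basis p g omega ->
  x != 0 -> x = synthesis tau u -> x = synthesis omega v ->
  1 / max_coherence f omega
    <= (norm0 u)%:R `^ p^-1 * (norm0 v)%:R `^ q^-1.
Proof.
move=> p1 pq [_ ftau _ ntau] [_ _ _ nomega] x0 xu xv.
have p0 : 0 < p := lt_trans ltr01 p1.
have q0 : 0 < q by rewrite -invr_gt0 -(addKr p^-1 q^-1) pq addrC subr_gt0 invf_lt1.
set M := max_coherence f omega; set A := _ `^ _; set B := _ `^ _.
pose V1 : R := \sum_i rnorm (v 0 i).
have N_gt0 : 0 < rnorm x by rewrite lt_def rnorm_eq0 x0 rnorm_ge0.
have M_ge0 : 0 <= M by rewrite /M /max_coherence bigmax_idl le_max lexx.
have V1_ge0 : 0 <= V1 by apply: sumr_ge0 => i _; exact: rnorm_ge0.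
have V1_le : V1 <= B * rnorm x.
  rewrite {1}xv nomega /B.
  have := sum_le_supp_powR p0 q0 pq (fun i => rnorm_ge0 (v 0 i)).
  (* Passing to moduli does not change the support. *)
  rewrite (_ : #|_| = norm0 v)//.
  by apply: eq_card => i; rewrite !inE rnorm_eq0.
have u_le j : rnorm (u 0 j) <= M * V1.
  rewrite -(ftau u j) -xu xv linear_sum; apply: le_trans (ler_rnorm_sum _) _.
  rewrite mulr_sumr; apply: ler_sum => i _.
  by rewrite linearZ rnormM mulrC ler_wpM2r ?rnorm_ge0 ?max_coherence_ge.
have N_le : rnorm x <= A * (M * V1).
  have MV_ge0 : 0 <= M * V1 by rewrite mulr_ge0.
  rewrite [leLHS](congr1 _ xu) ntau.
  (* Moving [M * V1] under the p-th root leaves only sums of p-th powers to compare, by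
     monotonicity. *)
  have MVE : M * V1 = ((M * V1) `^ p) `^ p^-1.
    by rewrite -powRrM divff ?powRr1// lt0r_neq0.
  rewrite {1}MVE /A -powRM ?powR_ge0//.
  apply: ge0_ler_powR; rewrite ?nnegrE ?invr_ge0 ?(ltW p0)//.
  - by apply: sumr_ge0 => j _; exact: powR_ge0.
  - by rewrite mulr_ge0 ?powR_ge0.
  (* The right-hand side becomes a sum of (M V1)^p over the support of [u]; off the support the left
     term is 0^p = 0. *)
  rewrite mulr_natl -sumr_const [leRHS]big_mkcond; apply: ler_sum => j _.
  rewrite inE; case: eqP => /= [->|_].
    by rewrite /rnorm normr0 realpart0 powR0 ?lt0r_neq0.
  by apply: ge0_ler_powR; rewrite ?nnegrE ?rnorm_ge0 ?(ltW p0).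
have ABM_ge1 : 1 <= A * B * M.
  rewrite -(ler_pM2r N_gt0) mul1r; apply: le_trans N_le _.
  by rewrite -!mulrA ler_wpM2l ?powR_ge0// [leRHS]mulrCA ler_wpM2l.
(* M = 0 would turn the bound just proved into 1 <= 0; positivity is what allows dividing by M. *)
have M_gt0 : 0 < M.
  rewrite lt_def M_ge0 andbT; apply: contraTneq ABM_ge1 => ->.
  by rewrite mulr0 ler10.
by rewrite ler_pdivrMr.
Qed.

End Uncertainty.

Theorem theorem2p7 (R : realType) (k : scalars)
    (X : completeNormedModType (scalar_field R k)) (n : nat) (p q : R)
    (hp : 1 < p) (hpq : p^-1 + q^-1 = 1)
    (f g : 'I_n -> {linear X -> (scalar_field R k)^o})
    (tau omega : 'I_n -> X)
    (htau : p_orthonormal_basis p f tau)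
    (homega : p_orthonormal_basis p g omega)
    (x : X) (hx : x != 0) (u v : 'rV[scalar_field R k]_n)
    (hu : x = synthesis tau u) (hv : x = synthesis omega v) :
  1 / max_coherence f omega
    <= (norm0 u)%:R `^ p^-1 * (norm0 v)%:R `^ q^-1 /\
  1 / max_coherence g tau
    <= (norm0 v)%:R `^ p^-1 * (norm0 u)%:R `^ q^-1.
Proof.
split; first exact: (norm0_uncertainty hp hpq htau homega hx hu hv).
exact: (norm0_uncertainty hp hpq homega htau hx hv hu).
Qed.
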